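(* Let $p\in(0,\infty)$, $s\in(0,1)$ and $\gamma\in(0,\infty)$. There exists a constant $C>0$ depending only on $p,s,\gamma$ such that for every $d\ge 1$ and every $f\in L^p(\mathbb{R}^d)$, $$[f]_{X^{\gamma,p}}\le C\,\|f\|_{L^p}\,\Big[\log\Big(2+\frac{\|f\|_{W^{s,p}}}{\|f\|_{L^p}}\Big)\Big]^{\gamma},$$ where the right-hand side is understood to be $0$ if $\|f\|_{L^p}=0$, and $+\infty$ if $\|f\|_{L^p}\neq 0$ and $\|f\|_{W^{s,p}}=+\infty$.
   Context: Functions are real-valued and measurable, and $B_r$ is the open Euclidean ball of radius $r$ centered at the origin of $\mathbb{R}^d$. For $p,\gamma\in(0,\infty)$, $$[f]_{X^{\gamma,p}}:=\left(\int_{B_{1/3}}\int_{\mathbb{R}^d}\frac{|f(x+h)-f(x)|^p}{|h|^d}\,\frac{1}{[\log(1/|h|)]^{1-p\gamma}}\,dx\,dh\right)^{1/p}.$$ For $s\in(0,1)$, $$[f]_{W^{s,p}}:=\left(\int_{\mathbb{R}^d}\int_{\mathbb{R}^d}\frac{|f(x+h)-f(x)|^p}{|h|^{d+ps}}\,dx\,dh\right)^{1/p},\qquad \|f\|_{W^{s,p}}^p:=\|f\|_{L^p}^p+[f]_{W^{s,p}}^p,$$ with values in $[0,\infty]$. *)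

(* Defs.v *)
From HB Require Import structures.
From mathcomp Require Import all_boot all_order all_algebra.
From mathcomp Require Import all_classical all_reals all_analysis.
From mathcomp Require Import measurable_realfun.
Set Implicit Arguments.
Unset Strict Implicit.
Unset Printing Implicit Defensive.
Import Order.TTheory GRing.Theory Num.Theory.
Import numFieldNormedType.Exports.
Local Open Scope classical_set_scope.
Local Open Scope ring_scope.

(* R^d is [d.-tuple R] with the library's product sigma-algebra, i.e. the
   Borel sigma-algebra of R^d. *)
Notation Rn R d := (d.-tuple (measurableTypeR R)).

Section LebesgueMeasureRn.
Context {R : realType}.
Local Open Scope ereal_scope.

Section cons.
Context {d : nat} (mu : {sigma_finite_measure set (Rn R d) -> \bar R}).

Definition consRn (x : measurableTypeR R * Rn R d) : Rn R d.+1 :=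
  [tuple of x.1 :: x.2].

Lemma measurable_consRn : measurable_fun setT consRn.
Proof. exact: (measurable_cons measurable_fst measurable_snd). Qed.

Definition lebesgue_cons : set (Rn R d.+1) -> \bar R :=
  pushforward ((@lebesgue_measure R) \x mu) consRn.

Let lebesgue_cons0 : lebesgue_cons set0 = 0.
Proof. by rewrite /lebesgue_cons /pushforward preimage_set0 measure0. Qed.

Let lebesgue_cons_ge0 A : 0 <= lebesgue_cons A.
Proof. exact: (measure_ge0 ((@lebesgue_measure R) \x mu)). Qed.

Let lebesgue_cons_sigma_additive : semi_sigma_additive lebesgue_cons.
Proof.
rewrite /lebesgue_cons => F mF tF mUF; rewrite /pushforward preimage_bigcup.
have mpre A : measurable A -> measurable (consRn @^-1` A).
  by move=> mA; rewrite -[X in measurable X]setTI; exact: measurable_consRn.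
apply: measure_semi_sigma_additive.
- by move=> n; exact: mpre.
- apply/trivIsetP => /= i j _ _ ij; rewrite -preimage_setI.
  by move/trivIsetP : tF => /(_ _ _ _ _ ij) ->//; rewrite preimage_set0.
- by rewrite -preimage_bigcup; exact: mpre.
Qed.

HB.instance Definition _ := isMeasure.Build _ _ _
  lebesgue_cons lebesgue_cons0 lebesgue_cons_ge0 lebesgue_cons_sigma_additive.

Lemma lebesgue_consE (A : set (measurableTypeR R)) (B : set (Rn R d)) C :
  measurable A -> measurable B ->
  (forall a b, C (consRn (a, b)) <-> A a /\ B b) ->
  lebesgue_cons C = lebesgue_measure A * mu B.
Proof.
move=> mA mB CAB; rewrite -product_measure1E// /lebesgue_cons /pushforward.
by congr product_measure1; apply/seteqP; split => -[x y] /CAB.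
Qed.

Let lebesgue_cons_sigma_finite : sigma_finite setT lebesgue_cons.
Proof.
have /sigma_finiteP[F [TF ndF Foo]] := sigma_finiteT (@lebesgue_measure R).
have /sigma_finiteP[G [TG ndG Goo]] := sigma_finiteT mu.
pose tl (z : Rn R d.+1) : Rn R d := [tuple of behead z].
have tlK a b : tl (consRn (a, b)) = b by exact/val_inj.
have mtl : measurable_fun setT tl by exact: measurable_behead.
pose H n := [set z : Rn R d.+1 | F n (tnth z ord0) /\ G n (tl z)].
have Hcons n a b : H n (consRn (a, b)) <-> F n a /\ G n b.
  by rewrite /H /= tlK (tnth_nth 0%R).
exists H.
  apply/seteqP; split => // z _.
  have [n _ Fn] : (\bigcup_n F n) (tnth z ord0) by rewrite -TF.
  have [k _ Gk] : (\bigcup_n G n) (tl z) by rewrite -TG.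
  exists (maxn n k) => //; split.
  - by move: Fn; exact/subsetPset/ndF/leq_maxl.
  - by move: Gk; exact/subsetPset/ndG/leq_maxr.
move=> n; have [mF Fn] := Foo n; have [mG Gn] := Goo n; split.
  apply: measurableI; rewrite -[X in measurable X]setTI.
  - exact: measurable_tnth.
  - exact: mtl.
by rewrite (lebesgue_consE mF mG (Hcons n)) lte_mul_pinfty// ge0_fin_numE.
Qed.

HB.instance Definition _ := Measure_isSigmaFinite.Build _ _ _
  lebesgue_cons lebesgue_cons_sigma_finite.

End cons.

Fixpoint lebesgueRn (d : nat) : {sigma_finite_measure set (Rn R d) -> \bar R} :=
  match d with
  | 0 => @dirac _ (Rn R 0) [tuple] R
  | d'.+1 => lebesgue_cons (lebesgueRn d')
  end.

Lemma lebesgueRn_box d (A : 'I_d -> set (measurableTypeR R)) :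
  (forall i, measurable (A i)) ->
  lebesgueRn d [set x | forall i, A i (tnth x i)] =
  \prod_(i < d) lebesgue_measure (A i).
Proof.
elim: d A => [|d IH] A mA.
  by rewrite big_ord0 /= diracE mem_set//= => -[].
rewrite big_ord_recl -IH//; apply: (@lebesgue_consE _ (lebesgueRn d)) => //.
- rewrite [X in measurable X](_ : _ =
    \bigcap_(i in [set: 'I_d]) ((@tnth d _ ^~ i) @^-1` A (lift ord0 i))).
    apply: fin_bigcap_measurable => // i _.
    rewrite -[X in measurable X]setTI.
    exact: measurable_tnth.
  by apply/seteqP; split => x /= Ax i; [move=> _; exact: (Ax i)|exact: (Ax i I)].
- move=> a b; split=> [Cab|[Aa Bb] i].
    split=> [|i]; first exact: (Cab ord0).
    by have := Cab (lift ord0 i); rewrite tnthS.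
  by have [j ->|->//] := unliftP ord0 i; rewrite tnthS; exact: Bb.
Qed.

End LebesgueMeasureRn.

Section Seminorms.
Context {R : realType}.

Definition addRn d (x h : Rn R d) : Rn R d :=
  [tuple (tnth x i : R) + tnth h i | i < d].

Definition enorm d (x : Rn R d) : R :=
  Num.sqrt (\sum_(i < d) (tnth x i : R) ^+ 2).

Definition Rn_ball d (r : R) : set (Rn R d) := [set x | enorm x < r].

(* The measure [lebesgueRn d] lives on the Borel sigma-algebra; Lebesgue
   measurability refers to its completion. The library's integral of a
   nonnegative function is a supremum over Borel simple functions, so it agrees
   with the integral for the completed measure on Lebesgue measurable
   functions. *)
Definition lebesgue_measurable d (f : Rn R d -> R) : Prop :=
  forall B : set R, measurable B ->
    completed_algebra_gen (lebesgueRn d) (f @^-1` B).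

Definition Lp_mem d (p : R) (f : Rn R d -> R) : Prop :=
  lebesgue_measurable f /\ finite_norm (lebesgueRn d) p%:E f.

Local Open Scope ereal_scope.

Definition Lp_norm d (p : R) (f : Rn R d -> R) : \bar R :=
  Lnorm (lebesgueRn d) p%:E (EFin \o f).

(* In both seminorms below the integrand is meaningful for h != 0 only; the
   value that the conventions 0^-1 = 0 and ln 0 = 0 give it at h = 0 is
   irrelevant for d >= 1. *)
Definition X_seminorm d (gamma p : R) (f : Rn R d -> R) : \bar R :=
  (\int[lebesgueRn d]_(h in Rn_ball 3^-1) \int[lebesgueRn d]_x
     (`|f (addRn x h) - f x| `^ p / enorm h ^+ d
      * (1 / (ln (1 / enorm h) `^ (1 - p * gamma))))%:E) `^ p^-1.

Definition W_seminorm d (s p : R) (f : Rn R d -> R) : \bar R :=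
  (\int[lebesgueRn d]_h \int[lebesgueRn d]_x
     (`|f (addRn x h) - f x| `^ p / enorm h `^ (d%:R + p * s))%:E) `^ p^-1.

Definition W_norm d (s p : R) (f : Rn R d -> R) : \bar R :=
  (Lp_norm p f `^ p + W_seminorm s p f `^ p) `^ p^-1.

End Seminorms.

(* Main.v *)
(** Let a = p * gamma, let U(h) be the integral of |f(x+h) - f(x)|^p in x and
    let L = ln (1/|h|).  The ball |h| < 1/3 (where L > 1, as e < 3) is cut at
    L = m + 1.  Beyond the cut, |h|^(p s) L^(a-1) is at most a multiple of
    exp (- p s m / 2), so that part is controlled by the W^{s,p} seminorm.
    Before the cut, U(h) <= 2^(p+1) ||f||_p^p, and on each shell
    k + 1 < L <= k + 2 the weight |h|^(-d) L^(a-1) has integral at most a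
    multiple of (k+1)^(a-1); these sum to a multiple of m^a.  Taking m
    comparable to (2/s) ln (2 + ||f||_{W^{s,p}} / ||f||_p) concludes.

    The constants do not depend on d because the volume of the ball of radius r
    is at most exp (pi e^2) (r/e)^d, which compensates the factor e^d lost in
    bounding |h|^(-d) on a shell.

    A Lebesgue measurable f is first replaced by a Borel function equal to it
    almost everywhere. *)
Require Import Defs.
From HB Require Import structures.
From mathcomp Require Import all_boot all_order all_algebra.
From mathcomp Require Import all_classical all_reals all_analysis.
From mathcomp Require Import measurable_realfun.
From mathcomp Require Import zify ring lra.
Set Implicit Arguments.
Unset Strict Implicit.
Unset Printing Implicit Defensive.
Import Order.TTheory GRing.Theory Num.Theory.
Import numFieldNormedType.Exports.
Local Open Scope classical_set_scope.
Local Open Scope ring_scope.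

(** * Lebesgue measure on R^d: Tonelli, translation invariance, product densities *)

Section LebesgueRn.
Context {R : realType}.
Local Open Scope ereal_scope.
Local Notation leb := (@lebesgue_measure R).

Lemma ge0_integral_lebesgueRnS d (F : Rn R d.+1 -> \bar R) :
  measurable_fun setT F -> (forall x, 0 <= F x) ->
  \int[lebesgueRn d.+1]_z F z =
  \int[leb]_x \int[lebesgueRn d]_y F (consRn (x, y)).
Proof.
move=> mF F0.
transitivity (\int[pushforward (leb \x lebesgueRn d) (@consRn R d)]_z F z) => //.
rewrite ge0_integral_pushforward//; last exact: measurable_consRn.
have mFc : measurable_fun setT (F \o @consRn R d).
  by apply: measurableT_comp => //; exact: measurable_consRn.
rewrite preimage_setT fubini_tonelli1// => x; exact: F0.
Qed.

(** The image of Lebesgue measure under a translation gives half-open intervals their length, so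
    uniqueness identifies it with Lebesgue measure. *)
Lemma ge0_integral_lebesgue_translate (F : measurableTypeR R -> \bar R) (a : R) :
  measurable_fun setT F -> (forall x, 0 <= F x) ->
  \int[leb]_x F (x + a)%R = \int[leb]_x F x.
Proof.
move=> mF F0.
pose phi (x : measurableTypeR R) : measurableTypeR R := (x + a)%R.
have mphi : measurable_fun setT phi by exact: measurable_funD.
transitivity (\int[pushforward leb phi]_x F x).
  by rewrite ge0_integral_pushforward// preimage_setT.
apply: eq_measure_integral => //= A mA _; apply/esym.
apply: lebesgue_measure_unique => //= _ [[x y]] _ <-.
rewrite /pushforward/= [X in _ = lebesgue_measure X](_ : _ = `]x - a, y - a]%classic)%R.
  by rewrite !lebesgue_measure_itv/= !lte_fin ltrD2r -!EFinB opprB addrA subrK.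
by apply/seteqP; split => z /=; rewrite !in_itv/= ltrBlDr lerBrDr.
Qed.

Lemma addRn_consRn d (x : R) (y : Rn R d) (h : Rn R d.+1) :
  addRn (consRn (x, y)) h =
  consRn ((x + tnth h ord0)%R, addRn y [tuple of behead h]).
Proof.
apply/eq_from_tnth => i; rewrite tnth_mktuple.
have [j ->|->] := unliftP ord0 i; last by rewrite !(tnth_nth 0%R).
rewrite !tnthS tnth_mktuple; congr (_ + _)%R.
by rewrite !(tnth_nth 0%R)/= nth_behead.
Qed.

Lemma measurable_addRn d (h : Rn R d) : measurable_fun setT (fun x => addRn x h).
Proof.
apply/measurable_fun_tnthP => i; rewrite (_ : _ \o _ =
  (fun x : Rn R d => (tnth x i : R) + tnth h i)%R).
  by apply: measurable_funD => //; exact: measurable_tnth.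
by apply/funext => x /=; rewrite tnth_mktuple.
Qed.

(** Induction on [d]: Tonelli splits off the first coordinate, which the one-dimensional case
    translates; the induction hypothesis translates the others. *)
Lemma ge0_integral_addRn d (F : Rn R d -> \bar R) (h : Rn R d) :
  measurable_fun setT F -> (forall x, 0 <= F x) ->
  \int[lebesgueRn d]_x F (addRn x h) = \int[lebesgueRn d]_x F x.
Proof.
elim: d F h => [|d IH] F h mF F0.
  by apply: eq_integral => x _; rewrite [addRn x h]tuple0 [x in RHS]tuple0.
rewrite !ge0_integral_lebesgueRnS//; last first.
  by apply: measurableT_comp => //; exact: measurable_addRn.
have mFc : measurable_fun setT (F \o @consRn R d).
  by apply: measurableT_comp => //; exact: measurable_consRn.
rewrite -[RHS](@ge0_integral_lebesgue_translate _ (tnth h ord0)); last 2 first.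
- apply: (measurable_fun_fubini_tonelli_F (F \o @consRn R d)) => [|x].
    exact: mFc.
  exact: F0.
- by move=> x; exact: integral_ge0.
apply: eq_integral => x _.
rewrite -[RHS](IH (fun y => F (consRn (_, y))) [tuple of behead h])//.
  by under eq_integral do rewrite addRn_consRn.
by apply: (measurableT_comp mFc); exact: measurable_fun_pair.
Qed.

Lemma lebesgueRn_translate d (h : Rn R d) A : measurable A ->
  lebesgueRn d ((fun x => addRn x h) @^-1` A) = lebesgueRn d A.
Proof.
move=> mA.
have mhA : measurable ((fun x => addRn x h) @^-1` A).
  by rewrite -[X in measurable X]setTI; exact: measurable_addRn.
have muE B : measurable B -> lebesgueRn d B = \int[lebesgueRn d]_x (\1_B x)%:E.
  by move=> mB; rewrite integral_indic// setIT.
rewrite !muE// -(ge0_integral_addRn h (F := fun x => (\1_A x)%:E))//.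
by apply/measurable_EFinP; exact: measurable_indic.
Qed.

(** With [u] a normal density, this normalizes the product Gaussian that serves to estimate the
    volume of balls. *)
Lemma integral_prod_lebesgueRn d (u : R -> R) :
  measurable_fun setT u -> (forall x, 0 <= u x)%R ->
  \int[leb]_x (u x)%:E = 1 ->
  \int[lebesgueRn d]_x (\prod_(i < d) u (tnth x i))%:E = 1.
Proof.
move=> mu u0 u1.
have mp k : measurable_fun setT (fun x : Rn R k => \prod_(i < k) u (tnth x i))%R.
  by apply: measurable_prod => i _; apply: measurableT_comp => //; exact: measurable_tnth.
have p0 k (x : Rn R k) : (0 <= \prod_(i < k) u (tnth x i))%R by exact: prodr_ge0.
elim: d => [|d IH].
  under eq_integral do rewrite big_ord0.
  by rewrite integral_cst//= diracT mule1.
rewrite ge0_integral_lebesgueRnS; last 2 first.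
- by apply/measurable_EFinP; exact: mp.
- by move=> x; rewrite lee_fin.
rewrite -[RHS]u1; apply: eq_integral => x _.
rewrite (eq_integral (fun y : Rn R d => (u x)%:E * (\prod_(i < d) u (tnth y i))%:E)).
  rewrite ge0_integralZl_EFin ?IH ?mule1//; first by move=> y _; rewrite lee_fin.
  by apply/measurable_EFinP; exact: mp.
move=> y _; rewrite big_ord_recl EFinM; congr (_ * _%:E).
by apply: eq_bigr => i _; rewrite tnthS.
Qed.

End LebesgueRn.

(** * Comparison of integrals off a null set *)

Section LowerIntegral.
Context d (T : measurableType d) (R : realType).
Variable mu : {measure set T -> \bar R}.
Local Open Scope ereal_scope.
Import HBNNSimple.

(* The two integrands need not be measurable: the integral of a nonnegative
   function is a supremum over the simple functions below it. *)
Lemma ge0_le_integral_negligible (N : set T) (u v : T -> \bar R) :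
  measurable N -> mu N = 0 ->
  (forall x, 0 <= u x) -> (forall x, 0 <= v x) ->
  (forall x, ~ N x -> u x <= v x) ->
  \int[mu]_x u x <= \int[mu]_x v x.
Proof.
move=> mN N0 u0 v0 uv; rewrite !ge0_integralTE//.
apply: ge_ereal_sup => _ [h /= hu <-].
have mNC := measurableC mN.
(* Cutting [h] off on the null set [N] keeps its integral and puts it below [v] everywhere. *)
have -> : sintegral mu h = sintegral mu (proj_nnsfun h mNC).
  rewrite -mrestrict -integral_nnsfun//.
  transitivity (\int[mu]_x (h x)%:E); first by rewrite integral_nnsfun// patch_setT.
  rewrite (ge0_negligible_integral mN)//.
  - by rewrite setTD.
  - exact/measurable_EFinP.
  - by move=> x _; rewrite lee_fin.
apply: ereal_sup_ubound; exists (proj_nnsfun h mNC) => //= x.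
rewrite mindicE; have [|] := boolP (x \in ~` N).
  by rewrite inE mulr1 => Nx; exact: le_trans (hu x) (uv _ Nx).
by rewrite mulr0.
Qed.

Lemma ge0_eq_integral_negligible (N : set T) (u v : T -> \bar R) :
  measurable N -> mu N = 0 ->
  (forall x, 0 <= u x) -> (forall x, 0 <= v x) ->
  (forall x, ~ N x -> u x = v x) ->
  \int[mu]_x u x = \int[mu]_x v x.
Proof.
move=> mN N0 u0 v0 uv; apply/le_anti/andP.
by split; apply: (ge0_le_integral_negligible mN) => // x /uv ->.
Qed.

End LowerIntegral.

(** * Borel representatives of Lebesgue measurable functions *)

Section BorelVersion.
Context {R : realType}.

(** For each rational [q], the set where [f > q] is a Borel set up to a negligible one. The
    countably many negligible sets lie in one Borel null set [N], and [g] is [f] reset to 0 on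
    [N]. *)
Lemma lebesgue_measurable_borel d (f : Rn R d -> R) : lebesgue_measurable f ->
  exists g : Rn R d -> R, exists N : set (Rn R d),
    [/\ measurable_fun setT g, measurable N, lebesgueRn d N = 0%E &
        forall x, ~ N x -> f x = g x].
Proof.
move=> mf.
have /choice[AN ANP] (q : rat) : exists AN : set (Rn R d) * set (Rn R d),
    [/\ measurable AN.1, (lebesgueRn d).-negligible AN.2 &
        AN.1 `|` AN.2 = f @^-1` `]ratr q, +oo[].
  have [A mA [N nN ANE]] := mf _ (measurable_itv `]ratr q, +oo[).
  by exists (A, N).
pose F k := if @unpickle rat k is Some q then (AN q).2 else set0.
have : (lebesgueRn d).-negligible (\bigcup_k F k).
  apply: negligible_bigcup => k; rewrite /F; case: unpickle => [q|].
    by have [] := ANP q.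
  exact: negligible_set0.
move=> [N [mN N0 FN]].
exists (fun x => if x \in N then 0 else f x), N; split => //; last first.
  by move=> x Nx; rewrite memNset.
move=> _; apply: (measurability _ (RGenOInfty.measurableE R)) => //.
move=> /= _ [_ [a ->] <-]; rewrite setTI.
(* The set where [g > a] is the union over rationals [q >= a] of the sets where [g > q]. Since [g]
   is 0 on [N], such a set contains [N] exactly when [q < 0]. *)
rewrite [X in measurable X](_ : _ = \bigcup_(q : rat)
    if a <= ratr q then ((AN q).1 `\` N) `|` (if ratr q < (0 : R) then N else set0)
    else set0); last first.
  have Nq q x : (AN q).2 x -> N x.
    by move=> ANx; apply: FN; exists (pickle q); [exact: I|rewrite /F pickleK].
  have fq q x : ~ N x -> (AN q).1 x <-> ratr q < f x.
    have [_ _ ANE] := ANP q => nNx.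
    have -> : ratr q < f x = ((AN q).1 `|` (AN q).2) x :> Prop.
      by rewrite ANE /= in_itv/= andbT.
    by split=> [|[//|/Nq//]]; left.
  apply/seteqP; split => x /=; rewrite in_itv/= andbT.
    case: ifPn => [/set_mem Nx|/negP nNx] /rat_in_itvoo[q].
      rewrite in_itv/= => /andP[aq q0]; exists q => //.
      by rewrite (ltW aq) q0; right.
    rewrite in_itv/= => /andP[aq qf]; exists q => //; rewrite (ltW aq).
    have nNx' : ~ N x by move=> /mem_set.
    by left; split => //; exact/fq.
  move=> [q _]; case: ifPn => // aq [[Aq nNx]|].
    by rewrite memNset//; apply: le_lt_trans aq _; exact/fq.
  by case: ifPn => // q0 Nx; rewrite mem_set//; exact: le_lt_trans aq q0.
apply: bigcupT_measurable_rat => q; case: ifP => // _.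
have [mA _ _] := ANP q.
by apply: measurableU; [exact: measurableD|case: ifP].
Qed.

End BorelVersion.

(** * The Euclidean norm and the volume of balls *)

Section EuclideanNorm.
Context {R : realType}.

Lemma enorm_ge0 d (x : Rn R d) : 0 <= enorm x.
Proof. exact: sqrtr_ge0. Qed.

Lemma measurable_enorm d : measurable_fun setT (@enorm R d).
Proof.
rewrite /enorm (_ : (fun x => _) =
    (fun x : Rn R d => (\sum_(i < d) (tnth x i : R) ^+ 2) `^ 2^-1)).
  apply: (measurableT_comp (measurable_powR _)).
  apply: (@measurable_sum _ _ _ _ _ _ (fun i (x : Rn R d) => (tnth x i : R) ^+ 2)).
  move=> i; apply: (@measurable_funX _ _ _ _ (fun x : Rn R d => tnth x i : R)).
  exact: measurable_tnth.
by apply/funext => x; rewrite powR12_sqrt// sumr_ge0// => i _; exact: sqr_ge0.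
Qed.

Lemma measurable_Rn_ball d (r : R) : measurable (@Rn_ball R d r).
Proof.
rewrite /Rn_ball (_ : [set x | _] = @enorm R d @^-1` `]-oo, r[%classic).
  rewrite -[X in measurable X]setTI.
  exact: (measurable_enorm measurableT (measurable_itv `]-oo, r[)).
by apply/seteqP; split => x /=; rewrite in_itv.
Qed.

(* Gaussian concentration: the standard deviation below makes the peak of the
   density equal to [e / r], and the exponential factor is at least
   [expR (- pi * e ^ 2)] on the ball. *)
Lemma lebesgueRn_ball_le d (r : R) : 0 < r ->
  (lebesgueRn d (Rn_ball r) <=
   (expR (pi * expR 1 ^+ 2) * (r / expR 1) ^+ d)%:E)%E.
Proof.
move=> r0; pose t : R := r / expR 1.
have t0 : 0 < t by rewrite divr_gt0// expR_gt0.
have p0 : 0 < pi :> R := pi_gt0 R.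
pose sg : R := t / Num.sqrt (pi *+ 2).
have s20 : 0 < Num.sqrt (pi *+ 2) :> R by rewrite sqrtr_gt0 mulrn_wgt0.
have sg0 : sg != 0 by rewrite gt_eqF// divr_gt0.
have sg2 : sg ^+ 2 = t ^+ 2 / (pi *+ 2).
  by rewrite /sg expr_div_n sqr_sqrtr// mulrn_wge0// ltW.
have pk : normal_peak sg = t^-1.
  rewrite /normal_peak sg2; congr (_ ^-1).
  rewrite -mulrnAr divfK; last by rewrite gt_eqF// mulrn_wgt0.
  by rewrite sqrtr_sqr gtr0_norm.
pose M : R := expR (pi * expR 1 ^+ 2).
have prodE (x : Rn R d) : \prod_(i < d) normal_pdf 0 sg (tnth x i : R) =
    t^-1 ^+ d * expR (- (enorm x ^+ 2) * (pi / t ^+ 2)).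
  under eq_bigr do rewrite normal_pdfE// pk /normal_fun.
  rewrite big_split/= prodr_const card_ord -expR_sum; congr (_ * expR _).
  rewrite sqr_sqrtr; last by apply: sumr_ge0 => i _; exact: sqr_ge0.
  rewrite -sumrN mulr_suml; apply: eq_bigr => i _; rewrite subr0.
  congr (_ * _); rewrite sg2 -mulr_natr invfM invf_div.
  by rewrite -[pi *+ 2]mulr_natr; field; rewrite gt_eqF.
have ball_le (x : Rn R d) : Rn_ball r x ->
    1 <= M * t ^+ d * \prod_(i < d) normal_pdf 0 sg (tnth x i : R).
  rewrite /Rn_ball/= => xr; rewrite prodE mulrA -[M * _ * _]mulrA -exprMn divff ?gt_eqF//.
  rewrite expr1n mulr1 -expRD -[leLHS]expR0 ler_expR mulNr subr_ge0.
  have -> : expR 1 ^+ 2 = r ^+ 2 / t ^+ 2 :> R.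
    by rewrite -expr_div_n /t invf_div mulrCA divff ?mulr1// gt_eqF.
  rewrite [leRHS]mulrCA ler_pM2r; last by rewrite divr_gt0// exprn_gt0.
  by rewrite ler_sqr ?nnegrE ?enorm_ge0 ?ltW.
have mprod : measurable_fun setT
    (fun x : Rn R d => (\prod_(i < d) normal_pdf 0 sg (tnth x i : R))%:E).
  apply/measurable_EFinP.
  apply: measurable_prod => i _; apply: (measurableT_comp (measurable_normal_pdf _ _)).
  exact: measurable_tnth.
have prod0 (x : Rn R d) : (0 <= (\prod_(i < d) normal_pdf 0 sg (tnth x i : R))%:E)%E.
  by rewrite lee_fin prodr_ge0// => i _; exact: normal_pdf_ge0.
have c0 : 0 <= M * t ^+ d by rewrite mulr_ge0 ?expR_ge0// exprn_ge0// ltW.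
have mball := @measurable_Rn_ball d r.
have int1 : (\int[lebesgueRn d]_x
    (\prod_(i < d) normal_pdf 0 sg (tnth x i : R))%:E)%E = 1%E.
  apply: integral_prod_lebesgueRn.
  - exact: measurable_normal_pdf.
  - by move=> x; exact: normal_pdf_ge0.
  - exact: integral_normal_pdf.
(* Integrate [ball_le] over the ball, then enlarge the domain to the whole space, where the density
   has integral 1. *)
apply: (@le_trans _ _ (\int[lebesgueRn d]_(x in Rn_ball r)
    ((M * t ^+ d)%:E * (\prod_(i < d) normal_pdf 0 sg (tnth x i : R))%:E)))%E.
  rewrite -[leLHS]mul1e -integral_cst//; apply: ge0_le_integral => //.
  by apply: measurable_funTS; exact: measurable_funeM.
rewrite -[leRHS]mule1 -int1 -ge0_integralZl_EFin//.
apply: ge0_subset_integral => //.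
- exact: measurable_funeM.
- by move=> x _; rewrite mule_ge0.
Qed.

End EuclideanNorm.

(** * Elementary inequalities for exponentials, powers and the logarithmic weight *)

Section RealEstimates.
Context {R : realType}.

(** From [1 + x <= expR x] at [x = -1/6] one gets [expR (1/6) <= 6/5], and the sixth power of [6/5]
    is just below 3. *)
Lemma expR1_lt3 : expR 1 < 3 :> R.
Proof.
have e6 : expR (6%:R^-1) <= (6 / 5 : R).
  have := expR_ge1Dx (- 6%:R^-1 : R); rewrite expRN => h.
  have p0 : 0 < expR (6%:R^-1 : R) := expR_gt0 _.
  rewrite -[leLHS]invrK -[leRHS]invrK lef_pV2 ?posrE ?invr_gt0//; lra.
have -> : (1 : R) = 6%:R * 6%:R^-1 by rewrite divff.
rewrite expRM_natl; apply: (@le_lt_trans _ _ ((6 / 5 : R) ^+ 6)).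
  by apply: lerXn2r e6; rewrite nnegrE; [exact: expR_ge0|lra].
by rewrite !exprS expr0; lra.
Qed.

Lemma expRN_le_half (y : R) : 0 <= y <= 1 -> expR (- y) <= 1 - y / 2.
Proof.
move=> /andP[y0 y1]; rewrite expRN.
apply: (@le_trans _ _ (1 + y)^-1).
  by rewrite lef_pV2 ?posrE ?expR_gt0 ?expR_ge1Dx//; lra.
by rewrite -div1r ler_pdivrMr; nra.
Qed.

(** A discrete form of comparing the derivative of [x ^ a] with its increments. With [n = k + 1] and
    [b = min(a, 1)], [(k/n)^a <= exp(-a/n) <= exp(-b/n) <= 1 - b/(2n)]; the minimum keeps [b/n] in
    [[0, 1]], as [expRN_le_half] requires. *)
Lemma powR_div_le_diff (a : R) (k : nat) : 0 < a ->
  k.+1%:R `^ a / k.+1%:R <=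
  2 / Num.min a 1 * (k.+1%:R `^ a - k%:R `^ a).
Proof.
move=> a0; set b := Num.min a 1.
have b0 : 0 < b by rewrite lt_min a0 ltr01.
have ba : b <= a by rewrite ge_min lexx.
have b1 : b <= 1 by rewrite ge_min lexx orbT.
have n0 : 0 < k.+1%:R :> R by rewrite ltr0n.
have n1 : 1 <= k.+1%:R :> R by rewrite ler1n.
have k0 : 0 <= k%:R :> R by [].
set n : R := k.+1%:R in n0 n1 *.
have kn : k%:R / n <= expR (- n^-1).
  apply: le_trans (expR_ge1Dx _).
  by rewrite ler_pdivrMr// mulrBl mul1r mulVf ?gt_eqF// /n -natr1 addrK.
have kna : (k%:R / n) `^ a <= 1 - b / n / 2.
  apply: (@le_trans _ _ (expR (- n^-1) `^ a)).
    apply: ge0_ler_powR => //; [exact: ltW| |exact: expR_ge0].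
    by rewrite nnegrE divr_ge0// ltW.
  rewrite -expRM mulNr.
  apply: (@le_trans _ _ (expR (- (b / n)))).
    by rewrite ler_expR lerN2 mulrC ler_pM2l ?invr_gt0.
  apply: expRN_le_half; apply/andP; split; first by rewrite divr_ge0// ltW.
  by rewrite ler_pdivrMr// mul1r; exact: le_trans b1 n1.
have -> : k%:R `^ a = n `^ a * (k%:R / n) `^ a.
  rewrite -powRM ?(ltW n0) ?divr_ge0 ?(ltW n0)//; congr (_ `^ _).
  by rewrite mulrCA divff ?mulr1// gt_eqF.
have na0 : 0 <= n `^ a := powR_ge0 _ _.
rewrite -{2}[n `^ a]mulr1 -mulrBr mulrCA ler_wpM2l//.
apply: (@le_trans _ _ (2 / b * (b / n / 2))).
  by rewrite le_eqVlt; apply/orP; left; apply/eqP; field; rewrite !gt_eqF.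
by rewrite ler_wpM2l ?divr_ge0 ?(ltW b0)// lerBrDr addrC -lerBrDr.
Qed.

(** The bounds of [powR_div_le_diff] telescope. *)
Lemma sum_powR_div_le (a : R) (m : nat) : 0 < a ->
  \sum_(k < m) (k.+1%:R `^ a / k.+1%:R) <= 2 / Num.min a 1 * m%:R `^ a.
Proof.
move=> a0; elim: m => [|m IH].
  by rewrite big_ord0 powR0 ?gt_eqF// mulr0.
rewrite big_ord_recr/=.
apply: (le_trans (lerD IH (powR_div_le_diff m a0))).
by rewrite -mulrDr subrKC.
Qed.

Lemma powR_weightE (a L : R) : 0 < L -> 1 / L `^ (1 - a) = L `^ a / L.
Proof.
move=> L0; rewrite div1r -powRN opprB powRB; last by rewrite (gt_eqF L0) implybT.
by rewrite powRr1// ltW.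
Qed.

(** Bounding [L^a] by [(2(k+1))^a] and [1/L] by [1/(k+1)] separately treats both signs of [a - 1] at
    once. *)
Lemma powR_weight_shell_le (a L : R) (k : nat) : 0 < a ->
  k.+1%:R <= L <= k.+2%:R ->
  1 / L `^ (1 - a) <= 2 `^ a * (k.+1%:R `^ a / k.+1%:R).
Proof.
move=> a0 /andP[kL Lk].
have n0 : 0 < k.+1%:R :> R by rewrite ltr0n.
have L0 : 0 < L := lt_le_trans n0 kL.
rewrite powR_weightE// mulrA -powRM ?(ltW n0)//.
apply: ler_pM; rewrite ?powR_ge0 ?invr_ge0 ?(ltW L0) ?lef_pV2 ?posrE//.
apply: ge0_ler_powR; rewrite ?nnegrE ?(ltW a0) ?(ltW L0) ?mulr_ge0//.
by apply: le_trans Lk _; rewrite -natrM ler_nat; lia.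
Qed.

(** Half of the exponential absorbs the power: with [c = q/(2a)], raising [c L <= exp(c L)] to the
    power [a] gives [L^a <= c^(-a) exp(q L/2)]. The other half is at most [exp(-q m/2)]. *)
Lemma powR_weight_tail_le (a q L : R) (m : nat) : 0 < a -> 0 < q ->
  1 <= L -> m%:R <= L ->
  1 / L `^ (1 - a) * expR (- (q * L)) <=
  (q / (2 * a)) `^ (- a) * expR (- (q * m%:R / 2)).
Proof.
move=> a0 q0 L1 mL; have L0 : 0 < L by exact: lt_le_trans L1.
have c0 : 0 < q / (2 * a) by rewrite divr_gt0// mulr_gt0.
set c := q / (2 * a) in c0 *.
have La : L `^ a <= c `^ (- a) * expR (q * L / 2).
  have -> : q * L / 2 = c * L * a by rewrite /c; field; rewrite gt_eqF.
  rewrite expRM powRN mulrC ler_pdivlMr ?powR_gt0// -powRM ?(ltW c0) ?(ltW L0)//.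
  rewrite [L * c]mulrC; apply: ge0_ler_powR; first exact: ltW.
  - by rewrite nnegrE mulr_ge0 ?(ltW c0) ?(ltW L0).
  - by rewrite nnegrE expR_ge0.
  - by apply: le_trans (expR_ge1Dx _); rewrite lerDr.
rewrite powR_weightE//.
apply: (@le_trans _ _ (L `^ a * expR (- (q * L)))).
  by rewrite ler_wpM2r ?expR_ge0// ler_pdivrMr// ler_peMr// powR_ge0.
apply: (@le_trans _ _ (c `^ (- a) * expR (q * L / 2) * expR (- (q * L)))).
  by rewrite ler_wpM2r ?expR_ge0.
rewrite -mulrA -expRD ler_wpM2l ?powR_ge0// ler_expR.
by nra.
Qed.

Lemma shell_index (L : R) (m : nat) : 1 < L -> L <= m.+1%:R ->
  exists k : 'I_m, k.+1%:R < L <= k.+2%:R.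
Proof.
move=> L1; elim: m => [|m IH] Lm; first by move: (le_lt_trans Lm L1); rewrite ltxx.
have [/IH[k kL]|mL] := leP L m.+1%:R.
  by exists (widen_ord (leqnSn m) k).
by exists ord_max; rewrite mL.
Qed.

End RealEstimates.

(** * Integrals of increments in the space variable *)

Section Increments.
Context {R : realType}.
Local Open Scope ereal_scope.

(** The integrands can differ only on [N] and on its preimage under the translation, both null. *)
Lemma ge0_eq_integral_increment d (f g : Rn R d -> R) (N : set (Rn R d))
    (F : R -> R -> \bar R) (h : Rn R d) :
  measurable N -> lebesgueRn d N = 0 -> (forall x, ~ N x -> f x = g x) ->
  (forall a b, 0 <= F a b) ->
  \int[lebesgueRn d]_x F (f (addRn x h)) (f x) =
  \int[lebesgueRn d]_x F (g (addRn x h)) (g x).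
Proof.
move=> mN N0 fg F0.
have mNh : measurable ((fun x => addRn x h) @^-1` N).
  by rewrite -[X in measurable X]setTI; exact: measurable_addRn.
apply: (@ge0_eq_integral_negligible _ _ _ _ (N `|` (fun x => addRn x h) @^-1` N)) => //.
- exact: measurableU.
- apply/le_anti; rewrite measure_ge0 andbT.
  apply: le_trans (measureU2 _ mN mNh) _.
  rewrite [X in _ + X <= _](lebesgueRn_translate h mN).
  by rewrite [X in X + _ <= _]N0 [X in _ + X <= _]N0 adde0.
- by move=> x /not_orP[Nx Nhx]; rewrite !fg.
Qed.

(** This is [U(h)] of the outline. *)
Definition increment_integral d (p : R) (g : Rn R d -> R) (h : Rn R d) : \bar R :=
  \int[lebesgueRn d]_x (`|g (addRn x h) - g x| `^ p)%:E.

Lemma increment_integral_ge0 d (p : R) (g : Rn R d -> R) h :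
  0 <= increment_integral p g h.
Proof. by apply: integral_ge0 => x _; rewrite lee_fin powR_ge0. Qed.

Section measurable_increment.
Context d (p : R) (g : Rn R d -> R).
Hypothesis mg : measurable_fun setT g.

Lemma measurable_addRn_pair :
  measurable_fun setT (fun hx : Rn R d * Rn R d => addRn hx.2 hx.1).
Proof.
apply/measurable_fun_tnthP => i; rewrite (_ : _ \o _ =
  (fun hx : Rn R d * Rn R d => (tnth hx.2 i : R) + tnth hx.1 i)%R).
  apply: measurable_funD.
    exact: (measurableT_comp (@measurable_tnth _ (measurableTypeR R) d i) measurable_snd).
  exact: (measurableT_comp (@measurable_tnth _ (measurableTypeR R) d i) measurable_fst).
by apply/funext => x /=; rewrite tnth_mktuple.
Qed.

Lemma measurable_increment_pair : measurable_fun setT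
  (fun hx : Rn R d * Rn R d => (`|g (addRn hx.2 hx.1) - g hx.2| `^ p)%:E).
Proof.
apply/measurable_EFinP; apply: (measurableT_comp (measurable_powR _)).
apply: (measurableT_comp (@normr_measurable _ _)); apply: measurable_funB.
  exact: (measurableT_comp mg measurable_addRn_pair).
exact: (measurableT_comp mg).
Qed.

Lemma measurable_increment (h : Rn R d) :
  measurable_fun setT (fun x => (`|g (addRn x h) - g x| `^ p)%:E).
Proof.
apply/measurable_EFinP; apply: (measurableT_comp (measurable_powR _)).
apply: (measurableT_comp (@normr_measurable _ _)); apply: measurable_funB => //.
exact: (measurableT_comp mg (measurable_addRn h)).
Qed.

Lemma measurable_increment_integral : measurable_fun setT (increment_integral p g).
Proof.
apply: (measurable_fun_fubini_tonelli_F
  (fun hx : Rn R d * Rn R d => (`|g (addRn hx.2 hx.1) - g hx.2| `^ p)%:E)) => [|hx].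
  exact: measurable_increment_pair.
by rewrite lee_fin powR_ge0.
Qed.

Lemma increment_integralM (h : Rn R d) (c : R) : (0 <= c)%R ->
  \int[lebesgueRn d]_x (`|g (addRn x h) - g x| `^ p * c)%:E =
  increment_integral p g h * c%:E.
Proof.
move=> c0; rewrite muleC -ge0_integralZl_EFin//.
- by apply: eq_integral => x _; rewrite mulrC EFinM.
- exact: measurable_increment.
Qed.

(** Covers [p < 1] and [p >= 1] together through [|a - b|^p <= (2 max(|a|, |b|))^p <= 2^p (|a|^p +
    |b|^p)]; translation invariance then makes both integrals equal. *)
Lemma increment_integral_le (h : Rn R d) : (0 < p)%R ->
  increment_integral p g h <=
  (2 * 2 `^ p)%:E * \int[lebesgueRn d]_x (`|g x| `^ p)%:E.
Proof.
move=> p0.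
have mgp : measurable_fun setT (fun x => (`|g x| `^ p)%:E).
  apply/measurable_EFinP; apply: (measurableT_comp (measurable_powR _)).
  exact: (measurableT_comp (@normr_measurable _ _)).
have mghp := measurableT_comp mgp (measurable_addRn h).
have p20 : (0 <= 2 `^ p :> R)%R := powR_ge0 _ _.
have gp0 x : 0 <= (`|g x| `^ p)%:E by rewrite lee_fin powR_ge0.
apply: (@le_trans _ _ (\int[lebesgueRn d]_x
    ((2 `^ p)%:E * ((`|g (addRn x h)| `^ p)%:E + (`|g x| `^ p)%:E)))).
  apply: ge0_le_integral => //.
  - exact: measurable_increment.
  - by apply: measurable_funeM; exact: emeasurable_funD.
  - move=> x _; rewrite -EFinD -EFinM lee_fin.
    set a := g (addRn x h); set b := g x.
    apply: (@le_trans _ _ ((2 * Num.max `|a| `|b|) `^ p)%R).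
      apply: ge0_ler_powR; rewrite ?nnegrE ?(ltW p0) ?mulr_ge0 ?le_max ?normr_ge0//.
      apply: le_trans (ler_normB _ _) _; rewrite mulr_natl mulr2n.
      by apply: lerD; rewrite le_max lexx ?orbT.
    rewrite powRM ?le_max ?normr_ge0// ler_wpM2l//.
    by have [_|_] := leP `|a|%R `|b|%R; [rewrite lerDr|rewrite lerDl]; exact: powR_ge0.
rewrite ge0_integralZl_EFin//; last 2 first.
- by move=> x _; exact: adde_ge0.
- exact: emeasurable_funD.
rewrite ge0_integralD//.
rewrite (ge0_integral_addRn h (F := fun x => (`|g x| `^ p)%:E))//.
set I := \int[lebesgueRn d]_x _; have I0 : 0 <= I by exact: integral_ge0.
by rewrite -mule2n -mule_natl muleA -EFinM mulrC.
Qed.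

End measurable_increment.
End Increments.

(** * Pointwise splitting of the logarithmic kernel *)

Section KernelBound.
Context {R : realType}.

Lemma log_kernel_ge0 d (h : Rn R d) (b : R) :
  0 <= (enorm h ^+ d)^-1 * (1 / ln (1 / enorm h) `^ b).
Proof.
by rewrite mulr_ge0 ?invr_ge0 ?exprn_ge0 ?enorm_ge0// div1r invr_ge0 powR_ge0.
Qed.

(** One term of the right-hand side suffices for each [h]: the first beyond the cut, otherwise that
    of the shell containing [h]. Shells are enlarged to balls, whose volume is under control. *)
Lemma log_kernel_le d (h : Rn R d) (a q : R) (m : nat) :
  (1 <= d)%N -> 0 < a -> 0 < q -> enorm h < 3^-1 ->
  (enorm h ^+ d)^-1 * (1 / ln (1 / enorm h) `^ (1 - a)) <=
  (q / (2 * a)) `^ (- a) * expR (- (q * m%:R / 2)) *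
    (enorm h `^ (d%:R + q))^-1 +
  \sum_(k < m) 2 `^ a * (k.+1%:R `^ a / k.+1%:R) * expR k.+2%:R ^+ d *
    \1_(Rn_ball (expR (- k.+1%:R)) : set (Rn R d)) h.
Proof.
move=> d1 a0 q0; set r := enorm h => r13.
have sum0 (P : pred 'I_m) : 0 <= \sum_(k < m | P k)
    2 `^ a * (k.+1%:R `^ a / k.+1%:R) * expR k.+2%:R ^+ d *
    \1_(Rn_ball (expR (- k.+1%:R)) : set (Rn R d)) h.
  apply: sumr_ge0 => k _; rewrite indicE; apply: mulr_ge0; last by case: (_ \in _).
  by rewrite !mulr_ge0 ?powR_ge0// exprn_ge0// expR_ge0.
have tail0 : 0 <= (q / (2 * a)) `^ (- a) * expR (- (q * m%:R / 2)) *
    (r `^ (d%:R + q))^-1.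
  by rewrite mulr_ge0 ?invr_ge0 ?mulr_ge0 ?powR_ge0 ?expR_ge0.
(* At the origin the left side is 0 by the convention [0^-1 = 0], as [d >= 1]. *)
have [r0|r0] := eqVneq r 0.
  by rewrite {1}r0 expr0n gtn_eqF// invr0 mul0r addr_ge0.
have rp : 0 < r by rewrite lt_neqAle eq_sym r0 enorm_ge0.
set L := ln (1 / r).
have rE : r = expR (- L) by rewrite /L div1r lnV ?posrE// opprK lnK.
have L1 : 1 < L.
  rewrite -ltrN2 -ltr_expR -rE expRN; apply: lt_trans r13 _.
  by rewrite ltf_pV2 ?posrE ?expR_gt0// expR1_lt3.
have [Lm|mL] := leP L m.+1%:R.
  have [k /andP[kL Lk]] := shell_index L1 Lm.
  apply: (@le_trans _ _ (2 `^ a * (k.+1%:R `^ a / k.+1%:R) * expR k.+2%:R ^+ d *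
      \1_(Rn_ball (expR (- k.+1%:R)) : set (Rn R d)) h)); last first.
    by rewrite (bigD1 k)//= addrCA lerDl addr_ge0.
  (* The strict bound [k + 1 < L] places [h] in the open ball; [L <= k + 2] bounds [r^(-d)] by
     [exp(k+2)^d]. *)
  rewrite indicE mem_set ?mulr1; last by rewrite /Rn_ball/= -/r rE ltr_expR ltrN2.
  rewrite mulrC; apply: ler_pM.
  - by rewrite div1r invr_ge0 powR_ge0.
  - by rewrite invr_ge0 exprn_ge0// ltW.
  - by apply: powR_weight_shell_le => //; rewrite (ltW kL).
  - rewrite -exprVn; apply: lerXn2r; rewrite ?nnegrE ?expR_ge0 ?invr_ge0 ?(ltW rp)//.
    by rewrite rE -expRN opprK ler_expR.
apply: ler_wpDr => //.
(* Beyond the cut, [r^(-d)] cancels on both sides, leaving the tail estimate for the weight times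
   [r^q = exp(-q L)]. *)
rewrite [r `^ _]powRD; last by rewrite r0 implybT.
rewrite powR_mulrn ?(ltW rp)// [(_ * r `^ q)^-1]invfM [leRHS]mulrCA.
rewrite ler_wpM2l ?invr_ge0 ?exprn_ge0 ?(ltW rp)//.
rewrite ler_pdivlMr ?powR_gt0//.
have -> : r `^ q = expR (- (q * L)) by rewrite rE -expRM mulNr mulrC.
apply: powR_weight_tail_le => //; first exact: ltW.
by rewrite (le_trans _ (ltW mL))// ler_nat.
Qed.

End KernelBound.

(** * The integrated bound, with constants independent of the dimension *)

Section LogIntegralBound.
Context {R : realType}.
Local Open Scope ereal_scope.

(** Integrates [log_kernel_le] against [U(h)]. The first term reproduces the Sobolev integral; in
    the ball terms [U(h)] is replaced by its uniform bound [B]. *)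
Lemma log_integral_le d (p q a I : R) (g : Rn R d -> R) (m : nat) :
  (1 <= d)%N -> (0 < p)%R -> (0 < q)%R -> (0 < a)%R ->
  measurable_fun setT g ->
  \int[lebesgueRn d]_x (`|g x| `^ p)%:E = I%:E ->
  \int[lebesgueRn d]_(h in Rn_ball 3^-1) \int[lebesgueRn d]_x
     (`|g (addRn x h) - g x| `^ p / enorm h ^+ d
      * (1 / (ln (1 / enorm h) `^ (1 - a))))%:E <=
  ((q / (2 * a)) `^ (- a) * expR (- (q * m%:R / 2)))%:E *
    \int[lebesgueRn d]_h \int[lebesgueRn d]_x
      (`|g (addRn x h) - g x| `^ p / enorm h `^ (d%:R + q))%:E +
  (2 * 2 `^ p * 2 `^ a * expR (pi * expR 1 ^+ 2) * (2 / Num.min a 1) * I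
     * m%:R `^ a)%:E.
Proof.
move=> d1 p0 q0 a0 mg gI.
set al := ((q / (2 * a)) `^ (- a) * _)%R.
have al0 : (0 <= al)%R by rewrite mulr_ge0 ?powR_ge0 ?expR_ge0.
have I0 : (0 <= I)%R.
  by rewrite -lee_fin -gI; apply: integral_ge0 => x _; rewrite lee_fin powR_ge0.
set Win := (X in al%:E * (\int[_]_h X h)).
pose U : Rn R d -> \bar R := increment_integral p g.
have U0 h : 0 <= U h := increment_integral_ge0 _ _ _.
pose B : R := (2 * 2 `^ p * I)%R.
have B0 : (0 <= B)%R by rewrite !mulr_ge0// powR_ge0.
have UB h : U h <= B%:E.
  by rewrite /B EFinM -gI; exact: increment_integral_le.
have WE h : Win h = U h * ((enorm h `^ (d%:R + q))^-1)%:E.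
  by rewrite /Win increment_integralM// invr_ge0 powR_ge0.
have W0 h : 0 <= Win h by rewrite WE mule_ge0// lee_fin invr_ge0 powR_ge0.
have mW : measurable_fun setT Win.
  rewrite (_ : Win = fun h => U h * ((enorm h `^ (d%:R + q))^-1)%:E); last exact/funext.
  apply: emeasurable_funM; first exact: measurable_increment_integral.
  apply/measurable_EFinP.
  rewrite (_ : (fun x => _) = (fun x : Rn R d => enorm x `^ (- (d%:R + q)))%R); last first.
    by apply/funext => x; rewrite powRN.
  exact: (measurableT_comp (measurable_powR _) (@measurable_enorm R d)).
pose be (k : 'I_m) : R :=
  (2 `^ a * (k.+1%:R `^ a / k.+1%:R) * expR k.+2%:R ^+ d)%R.
have be0 k : (0 <= be k)%R.
  by rewrite !mulr_ge0 ?powR_ge0// exprn_ge0// expR_ge0.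
pose D (k : 'I_m) : set (Rn R d) := Rn_ball (expR (- k.+1%:R)).
have mD k : measurable (D k) := @measurable_Rn_ball _ _ _.
have m1 k : measurable_fun setT (fun h => (\1_(D k) h : R)%:E).
  by apply/measurable_EFinP; exact: measurable_indic.
have t0 k h : 0 <= (B * be k)%:E * (\1_(D k) h : R)%:E.
  by rewrite -EFinM lee_fin !mulr_ge0.
have mt k : measurable_fun setT (fun h => (B * be k)%:E * (\1_(D k) h : R)%:E).
  exact: measurable_funeM.
apply: (@le_trans _ _ (\int[lebesgueRn d]_h
    (al%:E * Win h + \sum_(k < m) (B * be k)%:E * (\1_(D k) h : R)%:E))).
  rewrite integral_mkcond.
  (* With an empty null set this is monotonicity of the lower integral. *)
  apply: (@ge0_le_integral_negligible _ _ _ _ set0) => //.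
  - by move=> h; rewrite patchE; case: ifP => // _; apply: integral_ge0 => x _;
      rewrite lee_fin !mulr_ge0 ?invr_ge0 ?powR_ge0 ?exprn_ge0 ?enorm_ge0.
  - by move=> h; rewrite adde_ge0 ?mule_ge0// sume_ge0.
  - move=> h _; rewrite patchE; case: ifPn => [/set_mem hB|_]; last first.
      by rewrite adde_ge0 ?mule_ge0// sume_ge0.
    under eq_integral do rewrite -mulrA.
    rewrite increment_integralM//; last exact: log_kernel_ge0.
    rewrite WE -/(U h).
    have Ufin : U h \is a fin_num by rewrite ge0_fin_numE// (le_lt_trans (UB h))// ltry.
    have := UB h; have := U0 h; rewrite -(fineK Ufin); set u := fine (U h).
    rewrite !lee_fin => u0 uB.
    under eq_bigr do rewrite -EFinM.
    rewrite sumEFin -!EFinM -EFinD lee_fin.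
    apply: le_trans (ler_wpM2l u0 (log_kernel_le m d1 a0 q0 hB)) _.
    rewrite mulrDr mulrCA lerD2l mulr_sumr; apply: ler_sum => k _.
    by rewrite -/(be k) -/(D k) mulrA !ler_wpM2r// ler_wpM2r.
rewrite ge0_integralD//; last 4 first.
- by move=> h _; rewrite mule_ge0.
- exact: measurable_funeM.
- by move=> h _; rewrite sume_ge0.
- exact: emeasurable_sum.
rewrite ge0_integralZl_EFin//; apply: leeD2l.
rewrite ge0_integral_sum//.
apply: (@le_trans _ _ (\sum_(k < m) (B * (2 `^ a * (k.+1%:R `^ a / k.+1%:R)) *
    expR (pi * expR 1 ^+ 2))%:E)).
  apply: lee_sum => k _; rewrite ge0_integralZl_EFin//; last exact: mulr_ge0.
  rewrite integral_indic// setIT.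
  apply: le_trans (lee_wpmul2l _ (lebesgueRn_ball_le d (expR_gt0 _))) _.
    by rewrite lee_fin mulr_ge0.
  rewrite -EFinM lee_fin le_eqVlt; apply/orP; left; apply/eqP.
  (* The extra factor [1/e] in the volume bound exactly offsets the loss on the shell, so that the
     [d]-th powers multiply to 1. *)
  have e1 : (expR k.+2%:R * (expR (- k.+1%:R) / expR 1) = 1 :> R)%R.
    rewrite -expRN -!expRD -[RHS]expR0; congr expR.
    by rewrite -[k.+2%:R]natr1; ring.
  have ed : (expR k.+2%:R ^+ d * (expR (- k.+1%:R) / expR 1) ^+ d = 1 :> R)%R.
    by rewrite -exprMn e1 expr1n.
  rewrite /be; set E1 := (expR k.+2%:R ^+ d)%R in ed *.
  set E2 := (_ ^+ d)%R in ed *.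
  rewrite -[RHS]mulr1 -ed; ring.
rewrite sumEFin lee_fin.
under eq_bigr do rewrite mulrAC.
rewrite -mulr_sumr -mulr_sumr.
set M := expR _; have M0 : (0 <= M)%R := expR_ge0 _.
have c0 : (0 <= B * M * 2 `^ a)%R by rewrite !mulr_ge0// powR_ge0.
rewrite mulrA; apply: le_trans (ler_wpM2l c0 (sum_powR_div_le m a0)) _.
by rewrite le_eqVlt; apply/orP; left; apply/eqP; rewrite /B; ring.
Qed.

End LogIntegralBound.

(** * Choice of the cut-off *)

Section Conclusion.
Context {R : realType}.

(* The cut-off [m] makes the tail [expR (- p * s * m / 2) * v] at most [N ^ p]. *)
Lemma exists_log_cutoff (p s gamma c1 c2 N v : R) :
  0 < p -> 0 < s -> 0 < gamma -> 0 <= c1 -> 0 <= c2 -> 0 < N -> 0 <= v ->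
  exists m : nat,
    (c1 * expR (- (p * s * m%:R / 2)) * v + c2 * N `^ p * m%:R `^ (p * gamma))
      `^ p^-1 <=
    (c1 + c2 * (2 / s + 1) `^ (p * gamma)) `^ p^-1 * N *
      ln (2 + (N `^ p + v) `^ p^-1 / N) `^ gamma.
Proof.
move=> p0 s0 g0 c10 c20 N0 v0.
set W := (N `^ p + v) `^ p^-1; set T := ln _.
have Np0 : 0 < N `^ p := powR_gt0 _ N0.
have pn0 : p != 0 by rewrite gt_eqF.
have Wp : W `^ p = N `^ p + v.
  by rewrite /W -powRrM mulVf// powRr1// addr_ge0// ltW.
have W0 : 0 <= W := powR_ge0 _ _.
have NW : N <= W.
  rewrite -[leLHS](powRr1 (ltW N0)) -(mulfV pn0) powRrM.
  apply: ge0_ler_powR; rewrite ?nnegrE ?invr_ge0 ?(ltW p0) ?(ltW Np0)//.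
    by rewrite addr_ge0// ltW.
  by rewrite lerDl.
have WN1 : 1 <= W / N by rewrite ler_pdivlMr// mul1r.
have WN2 : 0 < 2 + W / N by lra.
(* Since [W / N >= 1], the argument of the logarithm is at least 3, hence above [e]. This lets the
   rounding error in [m] be absorbed into a multiple of [T]. *)
have T1 : 1 <= T.
  rewrite -ler_expR /T lnK ?posrE//.
  by have := @expR1_lt3 R; lra.
have eT : W / N <= expR T by rewrite /T lnK ?posrE//; lra.
have a0 : 0 < p * gamma by rewrite mulr_gt0.
have T0 : 0 <= 2 * T / s by rewrite divr_ge0 ?(ltW s0)//; lra.
(* Rounding [2T/s] up makes [p s m / 2 >= p T] while [m <= (2/s + 1) T]. *)
pose m := (Num.truncn (2 * T / s)).+1.
have mT : 2 * T / s <= m%:R by rewrite ltW// truncnS_gt.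
have mT' : m%:R <= (2 / s + 1) * T.
  have : (Num.truncn (2 * T / s))%:R <= 2 * T / s by rewrite truncn_le.
  rewrite /m -[(Num.truncn _).+1%:R]natr1.
  rewrite [(2 / s + 1) * T]mulrDl mul1r [2 / s * T]mulrAC => h.
  by rewrite lerD.
exists m; rewrite -mulrA.
(* Here [v <= W^p], and [W <= N exp(T)] by the definition of [T]. *)
have tail : expR (- (p * s * m%:R / 2)) * v <= N `^ p.
  apply: (@le_trans _ _ (expR (- (p * T)) * W `^ p)).
    apply: ler_pM; rewrite ?expR_ge0// ?Wp ?lerDr ?(ltW Np0)//.
    rewrite ler_expR lerN2 -!mulrA ler_wpM2l ?(ltW p0)//.
    by move: mT; rewrite ler_pdivrMr//; lra.
  rewrite expRN ler_pdivrMl ?expR_gt0// mulrC [p * T]mulrC expRM.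
  rewrite -powRM ?expR_ge0 ?(ltW N0)//.
  apply: ge0_ler_powR; rewrite ?nnegrE ?mulr_ge0 ?expR_ge0 ?(ltW p0) ?(ltW N0)//.
  by rewrite mulrC -ler_pdivrMr.
have Ta1 : 1 <= T `^ (p * gamma).
  have e1 : 1 `^ (p * gamma) = 1 :> R by rewrite powR1.
  by rewrite -[leLHS]e1; apply: ge0_ler_powR; rewrite ?nnegrE ?(ltW a0)//; lra.
have main : c1 * (expR (- (p * s * m%:R / 2)) * v) + c2 * N `^ p * m%:R `^ (p * gamma) <=
    (c1 + c2 * (2 / s + 1) `^ (p * gamma)) * (N `^ p * T `^ (p * gamma)).
  rewrite mulrDl; apply: lerD.
    rewrite ler_wpM2l//; apply: le_trans tail _.
    by rewrite ler_peMr// ltW.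
  rewrite -!mulrA ler_wpM2l// mulrCA ler_wpM2l ?(ltW Np0)//.
  have s1 : 0 <= 2 / s + 1 by rewrite addr_ge0// divr_ge0// ltW.
  rewrite -powRM//; last by lra.
  by apply: ge0_ler_powR; rewrite ?nnegrE ?(ltW a0)// mulr_ge0//; lra.
have C0 : 0 <= c1 + c2 * (2 / s + 1) `^ (p * gamma).
  by rewrite addr_ge0// mulr_ge0// powR_ge0.
have -> : (c1 + c2 * (2 / s + 1) `^ (p * gamma)) `^ p^-1 * N * T `^ gamma =
    ((c1 + c2 * (2 / s + 1) `^ (p * gamma)) * (N `^ p * T `^ (p * gamma))) `^ p^-1.
  rewrite powRM// ?mulr_ge0 ?powR_ge0// powRM ?powR_ge0// -!powRrM mulfV//.
  by rewrite [p * gamma / p]mulrAC mulfV// mul1r powRr1 ?(ltW N0)// mulrA.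
apply: ge0_ler_powR main; rewrite ?nnegrE ?invr_ge0 ?(ltW p0)//.
- by rewrite addr_ge0// !mulr_ge0// ?expR_ge0 ?powR_ge0.
- by rewrite mulr_ge0// mulr_ge0// powR_ge0.
Qed.

End Conclusion.

(** * Passage from an L^p function to a Borel one *)

Section BorelReduction.
Context {R : realType}.
Local Open Scope ereal_scope.

(** Quantifying over [F] after [g] lets the same [g] serve in both seminorms. *)
Lemma Lp_mem_borel d (p : R) (f : Rn R d -> R) : (0 < p)%R -> Lp_mem p f ->
  exists g : Rn R d -> R, [/\ measurable_fun setT g,
    \int[lebesgueRn d]_x (`|g x| `^ p)%:E = ((fine (Lp_norm p f)) `^ p)%:E &
    forall (F : R -> R -> \bar R) h, (forall a b, 0 <= F a b) ->
      \int[lebesgueRn d]_x F (f (addRn x h)) (f x) =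
      \int[lebesgueRn d]_x F (g (addRn x h)) (g x)].
Proof.
move=> p0 [/lebesgue_measurable_borel[g [N [mg mN N0 fg]]] fp].
exists g; split => // [|F h F0]; last exact: (ge0_eq_integral_increment h mN).
have Lfin : Lp_norm p f \is a fin_num by rewrite ge0_fin_numE// Lnorm_ge0.
rewrite -(poweR_EFin (fine _) p) (fineK Lfin) /Lp_norm.
rewrite poweR_Lnorm; last by rewrite gt_eqF.
apply: (ge0_eq_integral_negligible mN N0).
- by move=> x; rewrite lee_fin powR_ge0.
- by move=> x; exact: poweR_ge0.
- by move=> x /fg /= ->.
Qed.

End BorelReduction.

(** * Assembly of the estimate and its degenerate cases *)

Theorem proposition2p8 (R : realType) (p s gamma : R)
    (p_gt0 : 0 < p) (s_gt0 : 0 < s) (s_lt1 : s < 1) (gamma_gt0 : 0 < gamma) :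
  exists C : R, 0 < C /\
    forall (d : nat) (f : Rn R d -> R), (1 <= d)%N -> Lp_mem p f ->
      (X_seminorm gamma p f <=
        if Lp_norm p f == 0 then 0
        else if W_norm s p f == +oo then +oo
        else (C * fine (Lp_norm p f) *
              ln (2 + fine (W_norm s p f) / fine (Lp_norm p f)) `^ gamma)%:E)%E.
Proof.
have a0 : 0 < p * gamma by rewrite mulr_gt0.
have q0 : 0 < p * s by rewrite mulr_gt0.
have pn0 : p != 0 by rewrite gt_eqF.
have pV0 : 0 <= p^-1 by rewrite invr_ge0 ltW.
(* [c1] and [c2] are the constants of [log_integral_le] for [q = p s] and [a = p gamma], with the
   factor [I = N^p] left out of [c2]. *)
pose c1 : R := ((p * s) / (2 * (p * gamma))) `^ (- (p * gamma)).
pose c2 : R := 2 * 2 `^ p * 2 `^ (p * gamma) * expR (pi * expR 1 ^+ 2) *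
  (2 / Num.min (p * gamma) 1).
have c1_gt0 : 0 < c1 by rewrite powR_gt0// divr_gt0// mulr_gt0.
have c2_ge0 : 0 <= c2.
  rewrite !mulr_ge0 ?powR_ge0 ?expR_ge0// invr_ge0 le_min ler01.
  by rewrite ltW.
exists ((c1 + c2 * (2 / s + 1) `^ (p * gamma)) `^ p^-1); split.
  by rewrite powR_gt0// ltr_pwDl// mulr_ge0// powR_ge0.
move=> d f d1 fLp.
have [g [mg gN fgE]] := Lp_mem_borel p_gt0 fLp.
have L0 : (0 <= Lp_norm p f)%E := Lnorm_ge0 _ _ _.
have Lfin : Lp_norm p f \is a fin_num by rewrite ge0_fin_numE//; case: fLp.
set N := fine (Lp_norm p f) in gN *.
have LE : Lp_norm p f = N%:E by rewrite fineK.
have N0 : 0 <= N by rewrite fine_ge0.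
set Xg : \bar R := (\int[lebesgueRn d]_(h in Rn_ball 3^-1) \int[lebesgueRn d]_x
     (`|g (addRn x h) - g x| `^ p / enorm h ^+ d
      * (1 / (ln (1 / enorm h) `^ (1 - p * gamma))))%:E)%E.
have XE : X_seminorm gamma p f = (Xg `^ p^-1)%E.
  apply: (congr1 (fun J => (J `^ p^-1)%E)); apply: eq_integral => h _.
  apply: (fgE (fun a b => (`|a - b| `^ p / enorm h ^+ d *
    (1 / ln (1 / enorm h) `^ (1 - p * gamma)))%:E)) => a b.
  by rewrite lee_fin !mulr_ge0 ?invr_ge0 ?powR_ge0 ?exprn_ge0 ?enorm_ge0.
set Wg : \bar R := (\int[lebesgueRn d]_h \int[lebesgueRn d]_x
     (`|g (addRn x h) - g x| `^ p / enorm h `^ (d%:R + p * s))%:E)%E.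
have Wg0 : (0 <= Wg)%E.
  apply: integral_ge0 => h _; apply: integral_ge0 => x _.
  by rewrite lee_fin mulr_ge0 ?invr_ge0 ?powR_ge0.
have WE : W_seminorm s p f = (Wg `^ p^-1)%E.
  apply: (congr1 (fun J => (J `^ p^-1)%E)); apply: eq_integral => h _.
  apply: (fgE (fun a b => (`|a - b| `^ p / enorm h `^ (d%:R + p * s))%:E)) => a b.
  by rewrite lee_fin mulr_ge0 ?invr_ge0 ?powR_ge0.
have WnE : W_norm s p f = (((N `^ p)%:E + Wg) `^ p^-1)%E.
  rewrite /W_norm WE LE (poweR_EFin N p) -(poweRrM Wg).
  by rewrite (mulVf pn0) (poweRe1 Wg0).
have Xle m := log_integral_le m d1 p_gt0 q0 a0 mg gN.
rewrite -/Xg -/Wg -/c1 -/c2 in Xle.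
have Xg_ge0 : (0 <= Xg)%E.
  apply: integral_ge0 => h _; apply: integral_ge0 => x _.
  by rewrite lee_fin !mulr_ge0 ?invr_ge0 ?powR_ge0 ?exprn_ge0 ?enorm_ge0.
(* If the norm vanishes, so does [U(h)] for every [h], being at most a multiple of the integral of
   [|g|^p]. *)
have Xg_eq0 : N = 0 -> Xg = 0%E.
  move=> NE0; apply: integral0_eq => h hB.
  under eq_integral do rewrite -mulrA.
  rewrite (increment_integralM p mg h (log_kernel_ge0 h _)).
  suff -> : increment_integral p g h = 0%E by rewrite mul0e.
  apply/le_anti; rewrite increment_integral_ge0 andbT.
  apply: le_trans (increment_integral_le mg h p_gt0) _.
  by rewrite gN NE0 powR0// mule0.
clearbody Xg Wg; rewrite XE; case: ifPn => [/eqP|] LN.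
  by rewrite Xg_eq0 ?poweR0r ?invr_neq0// /N LN.
have Ngt0 : 0 < N by rewrite lt_neqAle N0 andbT eq_sym; move: LN; rewrite LE.
case: ifPn => [_|Woo]; first exact: leey.
(* An infinite [Wg] would make the Sobolev norm infinite, a case already settled. *)
have Wfin : Wg \is a fin_num.
  rewrite ge0_fin_numE// ltey; apply: contra Woo => /eqP Wy.
  by rewrite WnE Wy addey// poweRyr// invr_neq0.
set v := fine Wg; have vE : Wg = v%:E by rewrite fineK.
have v0 : 0 <= v by rewrite fine_ge0.
have -> : fine (W_norm s p f) = (N `^ p + v) `^ p^-1 by rewrite WnE vE.
have [m mle] := exists_log_cutoff p_gt0 s_gt0 gamma_gt0 (ltW c1_gt0) c2_ge0 Ngt0 v0.
rewrite -lee_fin in mle; apply: le_trans mle.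
rewrite -(poweR_EFin (c1 * _ * v + _) p^-1); apply: gt0_ler_poweR => //.
- by rewrite in_itv/= leey andbT.
- rewrite in_itv/= leey andbT lee_fin addr_ge0//.
    by rewrite !mulr_ge0 ?expR_ge0// ltW.
  by rewrite mulr_ge0 ?powR_ge0// mulr_ge0 ?powR_ge0.
- by apply: le_trans (Xle m) _; rewrite vE -EFinM -EFinD.
Qed.
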